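(* Let $K$ be an algebraically closed field of characteristic $2$, and let $X \subset \mathbb{P}^3_K$ be a quartic surface with equation of the form $$F(x) = a_1 \sigma_1^4 + a_2 \sigma_1^2 \sigma_2 + a_3 \sigma_1 \sigma_3 + a_4 \sigma_4 = 0,$$ where $(a_1,a_2,a_3,a_4) \in K^4 \setminus \{0\}$. Then $X$ has at least $6$ singular points (the $\mathfrak{S}_4$-orbit of $(0,0,1,1)$), and $X$ has either - exactly $6$ singular points, or - exactly $10$ singular points, the $4$ extra singular points being either the $\mathfrak{S}_4$-orbit of the point $(0,0,0,1)$ or the $\mathfrak{S}_4$-orbit of a point $(1,1,1,b)$, or - infinitely many singular points.
   Context: $\sigma_i$ denotes the $i$-th elementary symmetric function of the homogeneous coordinates $x_1,x_2,x_3,x_4$ of $\mathbb{P}^3_K$. The symmetric group $\mathfrak{S}_4$ acts on $\mathbb{P}^3_K$ by permuting the coordinates. Points of $\mathbb{P}^3_K$ are written in vector notation $(x_1,x_2,x_3,x_4)$, meaning the class of that vector up to nonzero scalars. Singular points are those where $F$ and all its partial derivatives vanish. *)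

(* Defs.v *)
From HB Require Import structures.
From mathcomp Require Import all_boot all_order all_algebra all_fingroup.
From mathcomp Require Import generic_quotient.
From mathcomp Require Export mpoly.
From mathcomp Require Import boolp classical_sets functions cardinality.

Set Implicit Arguments.
Unset Strict Implicit.
Unset Printing Implicit Defensive.

Import GRing.Theory.
Local Open Scope classical_set_scope.
Local Open Scope quotient_scope.
Local Open Scope ring_scope.

Section ProjectiveSpace.
Variable K : fieldType.

Definition nzvec := {v : 'rV[K]_4 | v != 0}.

Definition proportional (u v : nzvec) : bool :=
  `[< exists2 c : K, c != 0 & val v = c *: val u >].

Lemma proportional_refl : ssrbool.reflexive proportional.
Proof. by move=> u; apply/asboolP; exists 1; rewrite ?oner_neq0 ?scale1r. Qed.

Lemma proportional_sym : ssrbool.symmetric proportional.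
Proof.
suff H u v : proportional u v -> proportional v u.
  by move=> u v; apply/idP/idP; apply: H.
move=> /asboolP[c c0 vE]; apply/asboolP; exists c^-1; rewrite ?invr_eq0 //.
by rewrite vE scalerA mulVf // scale1r.
Qed.

Lemma proportional_trans : ssrbool.transitive proportional.
Proof.
move=> v u w /asboolP[c c0 vE] /asboolP[d d0 wE]; apply/asboolP.
by exists (d * c); rewrite ?mulf_neq0 // -scalerA -vE.
Qed.

Canonical proportional_equiv :=
  EquivRel proportional proportional_refl proportional_sym proportional_trans.

Definition P3 := {eq_quot proportional_equiv}.


Definition proj_class (v : 'rV[K]_4) (v0 : v != 0) : P3 :=
  \pi_P3 (exist _ v v0 : nzvec).

Definition vec4 (x1 x2 x3 x4 : K) : 'rV[K]_4 :=
  \row_j [:: x1; x2; x3; x4]`_j.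

Lemma vec4_eq0 x1 x2 x3 x4 :
  (vec4 x1 x2 x3 x4 == 0) = [&& x1 == 0, x2 == 0, x3 == 0 & x4 == 0].
Proof.
apply/eqP/and4P => [/rowP v0|[/eqP-> /eqP-> /eqP-> /eqP->]].
  have E (i : 'I_4) : [:: x1; x2; x3; x4]`_i = 0 by have := v0 i; rewrite !mxE.
  split; apply/eqP.
  - exact: (E (@Ordinal 4 0 isT)).
  - exact: (E (@Ordinal 4 1 isT)).
  - exact: (E (@Ordinal 4 2 isT)).
  - exact: (E (@Ordinal 4 3 isT)).
by apply/rowP => -[[|[|[|[|]]]] // i]; rewrite !mxE.
Qed.

Lemma vec0011_neq0 : vec4 0 0 1 1 != 0.
Proof. by rewrite vec4_eq0 oner_eq0 !andbF. Qed.

Lemma vec0001_neq0 : vec4 0 0 0 1 != 0.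
Proof. by rewrite vec4_eq0 oner_eq0 !andbF. Qed.

Lemma vec111b_neq0 b : vec4 1 1 1 b != 0.
Proof. by rewrite vec4_eq0 oner_eq0. Qed.

Lemma col_perm_neq0 (s : 'S_4) (v : 'rV[K]_4) : v != 0 -> col_perm s v != 0.
Proof.
apply: contra_neq => /rowP sv0; apply/rowP => j.
by have := sv0 ((s^-1)%g j); rewrite !mxE permKV.
Qed.

(* The action is computed on the canonical representative; S4act_class below
   shows that it does not depend on this choice. *)
Definition S4act (s : 'S_4) (p : P3) : P3 :=
  proj_class (col_perm_neq0 s (valP (repr p))).

Lemma S4act_class (s : 'S_4) (v : 'rV[K]_4) (v0 : v != 0) :
  S4act s (proj_class v0) = proj_class (col_perm_neq0 s v0).
Proof.
apply/eqmodP => /=; rewrite proportional_sym; apply/asboolP => /=.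
have /eqmodP /asboolP[c c0 /= vE] :
    \pi_P3 (exist _ v v0 : nzvec) = \pi_P3 (repr (proj_class v0)).
  by rewrite reprK.
exists c => //; rewrite vE.
by apply/rowP => j; rewrite !mxE.
Qed.

Definition S4orbit (p : P3) : set P3 := [set S4act s p | s in [set: 'S_4]].

(* The vanishing of F itself is required separately: Euler's relation does not
   give it when the characteristic divides deg F. *)
Definition singular_at (F : {mpoly K[4]}) (v : 'rV[K]_4) : Prop :=
  F.@[v 0] = 0 /\ forall i : 'I_4, (F^`M(i)).@[v 0] = 0.

Lemma meval_scale (F : {mpoly K[4]}) (d : nat) (c : K) (v : 'rV[K]_4) :
  F \is d.-homog -> F.@[(c *: v) 0] = c ^+ d * F.@[v 0].
Proof.
move=> /dhomogP Fd; rewrite !mevalE mulr_sumr !big_seq; apply: eq_bigr => m mF.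
rewrite mulrCA; congr (_ * _).
under eq_bigr do rewrite mxE exprMn.
rewrite big_split /= prodrXr; congr (c ^+ _ * _).
by rewrite -mdegE; exact: Fd mF.
Qed.

Lemma dhomog_mderiv (F : {mpoly K[4]}) (d : nat) (i : 'I_4) :
  F \is d.-homog -> F^`M(i) \is d.-1.-homog.
Proof.
move=> /dhomogP Fd; apply/dhomogP => m; rewrite mcoeff_msupp mcoeff_mderiv => mF.
have /Fd : (m + U_(i))%MM \in msupp F.
  by rewrite mcoeff_msupp; apply: contra_neq mF => ->; rewrite mul0rn.
by rewrite /= mdegD mdeg1 addn1 => <-.
Qed.

Lemma singular_at_scale (F : {mpoly K[4]}) (d : nat) (c : K) (v : 'rV[K]_4) :
  F \is d.-homog -> c != 0 -> singular_at F (c *: v) <-> singular_at F v.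
Proof.
move=> Fd c0; rewrite /singular_at (meval_scale _ _ Fd).
have E e x : c ^+ e * x = 0 <-> x = 0.
  split=> [/eqP|->]; last by rewrite mulr0.
  by rewrite mulf_eq0 expf_eq0 (negPf c0) andbF => /eqP.
have D i := meval_scale c v (dhomog_mderiv i Fd).
split=> -[F0 dF]; split=> [|i].
- exact/(E d).
- by apply/(E d.-1); rewrite -D.
- exact/(E d).
- by rewrite D; apply/E.
Qed.

(* Singular points of the zero locus of a homogeneous form F; for homogeneous F
   the condition is independent of the representative (singular_points_class). *)
Definition singular_points (F : {mpoly K[4]}) : set P3 :=
  [set p | singular_at F (val (repr p))].

Lemma singular_points_class (F : {mpoly K[4]}) (d : nat) (v : 'rV[K]_4)
    (v0 : v != 0) :
  F \is d.-homog -> singular_points F (proj_class v0) <-> singular_at F v.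
Proof.
move=> Fd; rewrite /singular_points /=.
have /eqmodP /asboolP[c c0 /= ->] :
    \pi_P3 (exist _ v v0 : nzvec) = \pi_P3 (repr (proj_class v0)).
  by rewrite reprK.
exact: singular_at_scale Fd c0.
Qed.

End ProjectiveSpace.

(* Main.v *)
Require Import Defs.
From HB Require Import structures.
From mathcomp Require Import all_boot all_order all_algebra all_fingroup.
From mathcomp Require Import generic_quotient.
From mathcomp Require Import finmap mpoly.
From mathcomp Require Import boolp classical_sets functions cardinality.
From mathcomp Require Import ring.

(** Write e_k for the elementary symmetric functions. In characteristic 2 the
    partial derivative of the quartic F with respect to x_i is G(x_i), for a
    single cubic polynomial G with leading coefficient a4 whose coefficients
    are symmetric in x. A singular point is thus a zero of F whose four
    coordinates are all roots of G.

    If a4 = 0, every point (1, 1, t, t) is singular, because e_1 and e_3 vanish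
    there. Otherwise F can be divided by a4.

    On the plane e_1 = 0 the equation F = 0 says that some coordinate vanishes,
    and the remaining coordinates satisfy t (t - r)^2 = 0 with r^2 = e_2. Since
    e_1 = 0, an even number of coordinates equals r, hence two of them, which
    gives exactly the orbit of (0, 0, 1, 1) ([singular_sum0]).

    Off that plane, scale so that e_1 = 1. Four coordinates cannot be distinct
    roots of a cubic, so the point is (a, a, b, b + 1) up to permutation.
    Modulo 2, G(u) = (u - a3)(u - b)(u - b - 1) + (a2 - a^2)(u + 1), so the
    point is singular if and only if a^2 = a2, a1 = a2 (a2 + a3), and a is one of a3,
    b, b + 1 ([singular_double_coordP]). The first condition determines a.
    Hence there is no further singular point when a1 differs from
    a2 (a2 + a3); there is a line of them, with b free, when equality holds and
    a = a3; in the remaining case the further points are the permutations of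
    (a, a, a, a + 1), which is (0, 0, 0, 1) if a = 0 and proportional to
    (1, 1, 1, (a + 1) / a) otherwise.

    For counting, the orbits are indexed by the subsets of the four coordinate
    positions of cardinal 2 and 1 ([card_range_twoval]), and the two orbits are
    disjoint since the coordinate sum vanishes on the first one only. *)

Set Implicit Arguments.
Unset Strict Implicit.
Unset Printing Implicit Defensive.

Import GRing.Theory.
Local Open Scope classical_set_scope.
Local Open Scope card_scope.
Local Open Scope ring_scope.

(** * Derivatives and values of elementary symmetric polynomials *)

Section ElementarySymmetric.
Variable R : comNzRingType.

(** A monomial of e_(k+1) containing x_i loses x_i under differentiation and
    becomes a monomial of e_k without x_i; the monomials of e_k with x_i are
    recovered by multiplying the derivative of e_k by x_i. Iterated over k, the
    identity expresses every derivative of e_k by x_i and e_0, ..., e_(k-1). *)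
Lemma mderiv_mesymS n k (i : 'I_n) :
  (mesym n R k.+1)^`M(i) + 'X_i * (mesym n R k)^`M(i) = mesym n R k.
Proof.
have monomE (h : {set 'I_n}) : 'X_[R, mesym1 h]^`M(i) =
    if i \in h then 'X_[mesym1 (h :\ i)] else 0.
  rewrite mderivX mnmE; case: ifPn => ih; last by rewrite scale0r.
  rewrite scale1r; congr 'X_[_]; apply/mnmP => j.
  by rewrite mnmBE !mnmE !inE eq_sym; case: eqP => [->|_]; rewrite ?ih ?subn0.
rewrite !mesymE !raddf_sum /=; under eq_bigr do rewrite monomE.
under [X in _ + _ * X]eq_bigr do rewrite monomE.
rewrite -!big_mkcondr /= [RHS](bigID (fun h : {set 'I_n} => i \in h)) /= addrC.
congr (_ + _); last first.
  rewrite mulr_sumr; apply: eq_bigr => h /andP[_ ih].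
  rewrite -mpolyXD; congr 'X_[_]; apply/mnmP => j.
  by rewrite mnmDE !mnmE !inE eq_sym; case: eqP => [->|_]; rewrite ?ih.
(* Removing x_i matches the monomials of e_(k+1) with x_i to those of e_k
   without it. *)
rewrite (reindex_onto (fun h => i |: h) (fun h => h :\ i)) /=; last first.
  by move=> h /andP[_ ih]; rewrite finset.setD1K.
apply: eq_big => [h|h /andP[_ /eqP -> //]].
rewrite finset.setU11 andbT cardsU1; case: (boolP (i \in h)) => ih /=.
  rewrite andbF; apply/negP => /andP[_ /eqP hE].
  by move: ih; rewrite -hE !inE eqxx.
by rewrite finset.setU1K // eqxx !andbT.
Qed.

(** Substituting polynomials for the variables covers both the permutation
    [msym] and the extension of the set of variables [mwiden], so that one
    evaluation rule serves the two lemmas below. *)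
Lemma meval_mmap n m (f : 'I_n -> {mpoly R[m]}) (p : {mpoly R[n]}) x :
  (mmap (@mpolyC m R) f p).@[x] = p.@[fun i => (f i).@[x]].
Proof.
transitivity (p \mPo [tuple f i | i < n]).@[x].
  congr (_.@[_]); apply: eq_bigr => u _; congr (_ * _).
  by apply: eq_bigr => i _; rewrite tnth_mktuple.
by rewrite comp_mpoly_meval; apply: meval_eq => i; rewrite tnth_mktuple.
Qed.

Lemma meval_mesym_perm n k (s : 'S_n) (x : 'I_n -> R) :
  (mesym n R k).@[x \o s] = (mesym n R k).@[x].
Proof.
rewrite -[in RHS]((issymP _ (mesym_sym n R k)) s) meval_mmap.
by apply: meval_eq => i /=; rewrite mevalXU.
Qed.

Lemma meval_mesymS n k (x : 'I_n.+1 -> R) :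
  (mesym n.+1 R k.+1).@[x] =
  (mesym n R k.+1).@[x \o widen_ord (leqnSn n)]
  + (mesym n R k).@[x \o widen_ord (leqnSn n)] * x ord_max.
Proof.
rewrite mesymSS mevalD mevalM mevalXU !meval_mmap.
by congr (_ + _ * _); apply: meval_eq => i /=; rewrite mevalXU.
Qed.

Lemma meval_mesym_vec4 (x y z t : R) k :
  (mesym 4 R k.+1).@[[eta nth 0 [:: x; y; z; t]] \o @nat_of_ord 4] =
    [:: x + y + z + t;
        x * y + (x + y) * z + (x + y + z) * t;
        x * y * z + (x * y + (x + y) * z) * t;
        x * y * z * t]`_k.
Proof.
case: k => [|[|[|[|k]]]]; last by rewrite nth_default // mesym_geqnE // meval0.
all: rewrite !(meval_mesymS, mesym0E, meval1) /=.
all: rewrite !mesym_geqnE // !meval0 /=; ring.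
Qed.

End ElementarySymmetric.

(** * Singular vectors of the symmetric quartics *)

Section CharTwo.
Variables (K : closedFieldType) (charK : 2%N \in [pchar K]).

Definition elemsym (k : nat) (x : 'rV[K]_4) : K := (mesym 4 K k).@[x 0].

Lemma elemsym_col_perm k (s : 'S_4) x : elemsym k (col_perm s x) = elemsym k x.
Proof.
rewrite /elemsym -[RHS](meval_mesym_perm _ s).
by apply: meval_eq => i /=; rewrite mxE.
Qed.

Lemma elemsym_vec4 k x y z t : elemsym k.+1 (vec4 x y z t) =
    [:: x + y + z + t;
        x * y + (x + y) * z + (x + y + z) * t;
        x * y * z + (x * y + (x + y) * z) * t;
        x * y * z * t]`_k.
Proof.
rewrite /elemsym -meval_mesym_vec4.
by apply: meval_eq => i /=; rewrite mxE.
Qed.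

Lemma elemsym1E x : elemsym 1 x = \sum_i x 0 i.
Proof.
rewrite /elemsym mesym1E raddf_sum /=; apply: eq_bigr => i _.
by rewrite mevalXU.
Qed.

Lemma elemsym4E x : elemsym 4 x = \prod_i x 0 i.
Proof.
rewrite /elemsym mesymnnE rmorph_prod /=; apply: eq_bigr => i _.
by rewrite mevalXU.
Qed.

Lemma elemsymZ k c x : elemsym k (c *: x) = c ^+ k * elemsym k x.
Proof. exact/meval_scale/dhomog_mesym. Qed.

Definition quartic (a1 a2 a3 a4 : K) : {mpoly K[4]} :=
  a1 *: mesym 4 K 1 ^+ 4 + a2 *: (mesym 4 K 1 ^+ 2 * mesym 4 K 2)
  + a3 *: (mesym 4 K 1 * mesym 4 K 3) + a4 *: mesym 4 K 4.

Lemma quartic_homog a1 a2 a3 a4 : quartic a1 a2 a3 a4 \is 4.-homog.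
Proof.
have h k := dhomog_mesym 4 K k.
have h11 : mesym 4 K 1 ^+ 2 \is 2.-homog := dhomogMn 2 (h 1%N).
have h1111 : mesym 4 K 1 ^+ 4 \is 4.-homog := dhomogMn 4 (h 1%N).
have h112 := dhomogM h11 (h 2%N); have h13 := dhomogM (h 1%N) (h 3%N).
rewrite !dhomogD //; apply: dhomogZ.
- exact: h1111.
- exact: h112.
- exact: h13.
- exact: h.
Qed.

Let two0 : 2 = 0 :> K.
Proof. exact: pcharf0 charK. Qed.

(** Identities modulo 2 are reduced to integral ones, which [ring] decides:
    the witness [q] is half of the difference of the two sides, computed over
    the integers. *)
Lemma mod2 (q x y : K) : x = y + 2 * q -> x = y.
Proof. by rewrite two0 mul0r addr0. Qed.

(** The partial derivatives of the quartic at x are the values at the four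
    coordinates t = x_i of one cubic polynomial in t, whose coefficients are
    symmetric functions of x. *)
Definition dquartic (a2 a3 a4 : K) (x : 'rV[K]_4) (t : K) : K :=
  a4 * t ^+ 3 + (a3 + a4) * elemsym 1 x * t ^+ 2
  + ((a2 + a3) * elemsym 1 x ^+ 2 + a4 * elemsym 2 x) * t
  + (a2 * elemsym 1 x ^+ 3 + a3 * (elemsym 3 x + elemsym 1 x * elemsym 2 x)
     + a4 * elemsym 3 x).

Lemma meval_mderiv_quartic a1 a2 a3 a4 (x : 'rV[K]_4) i :
  ((quartic a1 a2 a3 a4)^`M(i)).@[x 0] = dquartic a2 a3 a4 x (x 0 i).
Proof.
pose d k := ((mesym 4 K k)^`M(i)).@[x 0].
have dS k : d k.+1 = elemsym k x - x 0 i * d k.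
  have /(congr1 (meval (x 0))) := mderiv_mesymS K k i.
  by rewrite mevalD mevalM mevalXU /elemsym => <-; rewrite addrK.
have d0 : d 0%N = 0 by rewrite /d mesym0E -mpolyC1 mderivC meval0.
have e0 : elemsym 0 x = 1 by rewrite /elemsym mesym0E meval1.
rewrite /quartic !mderivD !mderivZ !exprS expr0 !mulr1 !mderivM.
rewrite !(mevalD, mevalZ, mevalM) -!/(d _) -!/(elemsym _ _) !dS d0 e0 /dquartic.
apply: (@mod2 (2 * a1 * elemsym 1 x ^+ 3
               + a2 * (elemsym 1 x * elemsym 2 x - elemsym 1 x ^+ 2 * x 0 i)
               - a3 * elemsym 1 x ^+ 2 * x 0 i
               - a4 * (x 0 i * elemsym 2 x + x 0 i ^+ 3))).
ring.
Qed.

Lemma singular_quarticP a1 a2 a3 a4 (x : 'rV[K]_4) :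
  singular_at (quartic a1 a2 a3 a4) x <->
  a1 * elemsym 1 x ^+ 4 + a2 * (elemsym 1 x ^+ 2 * elemsym 2 x)
    + a3 * (elemsym 1 x * elemsym 3 x) + a4 * elemsym 4 x = 0
  /\ forall i, dquartic a2 a3 a4 x (x 0 i) = 0.
Proof.
rewrite /singular_at {1}/quartic !(mevalD, mevalZ, mevalM, rmorphXn) /=.
rewrite -!/(elemsym _ _).
split=> -[-> dF]; split=> // i; first by rewrite -(meval_mderiv_quartic a1) dF.
by rewrite meval_mderiv_quartic dF.
Qed.

Lemma singular_col_perm a1 a2 a3 a4 (s : 'S_4) (x : 'rV[K]_4) :
  singular_at (quartic a1 a2 a3 a4) (col_perm s x) <->
  singular_at (quartic a1 a2 a3 a4) x.
Proof.
rewrite !singular_quarticP !elemsym_col_perm.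
have dE t : dquartic a2 a3 a4 (col_perm s x) t = dquartic a2 a3 a4 x t.
  by rewrite /dquartic !elemsym_col_perm.
split=> -[-> dF]; split=> // i; last by rewrite dE mxE.
by have := dF ((s^-1)%g i); rewrite dE mxE permKV.
Qed.

Lemma forall_vec4 (f : K -> K) x y z t :
  (forall i, f (vec4 x y z t 0 i) = 0) <->
  [/\ f x = 0, f y = 0, f z = 0 & f t = 0].
Proof.
split=> [Pv|[Px Py Pz Pt] i]; last by rewrite mxE; case: i => -[|[|[|[|]]]].
split; [have := Pv 0|have := Pv 1|have := Pv 2%:R|have := Pv 3%:R];
  by rewrite mxE.
Qed.

Lemma vec4_eta (x : 'rV[K]_4) : x = vec4 (x 0 0) (x 0 1) (x 0 2%:R) (x 0 3%:R).
Proof.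
by apply/rowP => i; rewrite mxE; case: i => -[|[|[|[|]]]] //= ?;
  congr (x 0 _); apply: val_inj.
Qed.

Lemma singular_two_pairs a1 a2 a3 t :
  singular_at (quartic a1 a2 a3 0) (vec4 1 1 t t).
Proof.
have e1 : elemsym 1 (vec4 1 1 t t) = 0.
  by rewrite elemsym_vec4 /=; apply: (@mod2 (1 + t)); ring.
have e3 : elemsym 3 (vec4 1 1 t t) = 0.
  by rewrite elemsym_vec4 /=; apply: (@mod2 (t + t ^+ 2)); ring.
apply/singular_quarticP; rewrite /dquartic e1 e3; split=> [|i]; ring.
Qed.

Lemma singular_vec0011 a1 a2 a3 a4 :
  singular_at (quartic a1 a2 a3 a4) (vec4 0 0 1 1).
Proof.
have e1 : elemsym 1 (vec4 0 0 1 1) = 0.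
  by rewrite elemsym_vec4 /=; apply: (@mod2 1); ring.
apply/singular_quarticP; split; first by rewrite e1 !elemsym_vec4 /=; ring.
apply/forall_vec4; rewrite /dquartic e1 !elemsym_vec4 /=.
by split; try ring; apply: (@mod2 a4); ring.
Qed.

(** A point with two equal coordinates and coordinate sum 1 is (a, a, b, b + 1)
    up to permutation. Vanishing of the derivative cubic at b and at b + 1
    forces a^2 = a2, after which the cubic splits with roots a3, b, b + 1, and
    the values of the quartic no longer depend on b. *)
Lemma singular_double_coordP a1 a2 a3 a b :
  singular_at (quartic a1 a2 a3 1) (vec4 a a b (b + 1)) <->
  [/\ a2 = a ^+ 2, a1 = a2 * (a2 + a3) & [\/ a = a3, b = a | b = a + 1]].
Proof.
set v := vec4 _ _ _ _.
have e1 : elemsym 1 v = 1.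
  by rewrite elemsym_vec4 /=; apply: (@mod2 (a + b)); ring.
have e2 : elemsym 2 v = a ^+ 2 + b ^+ 2 + b.
  by rewrite elemsym_vec4 /=; apply: (@mod2 (a * b + a * (b + 1))); ring.
have e3 : elemsym 3 v = a ^+ 2.
  rewrite elemsym_vec4 /=.
  by apply: (@mod2 (a ^+ 2 * b + a * b * (b + 1))); ring.
have e4 : elemsym 4 v = a ^+ 2 * (b ^+ 2 + b) by rewrite elemsym_vec4 /=; ring.
(* The first product is what remains of the cubic once a^2 = a2. *)
have dE u : dquartic a2 a3 1 v u =
    (u - a3) * (u - b) * (u - (b + 1)) + (a2 - a ^+ 2) * (u + 1).
  rewrite /dquartic e1 e2 e3.
  apply: (@mod2 ((a3 + b + 1) * u ^+ 2 + (a ^+ 2 - a3 * b) * u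
                 + a3 * a ^+ 2 + a3 * (b ^+ 2 + b) + a ^+ 2)).
  ring.
rewrite singular_quarticP e1 e2 e3 e4 forall_vec4 !dE.
split=> [[F0 []]|[-> -> abc]].
  move=> /eqP Da _ Db Db1.
  have a2E : a2 = a ^+ 2.
    apply/eqP; rewrite -subr_eq0 -[0](subrr 0) -{1}Db1 -Db; apply/eqP; ring.
  (* What is left of the derivative at a is (a - a3)(a - b)(a - (b + 1)). *)
  move: Da; rewrite a2E subrr mul0r addr0 !mulf_eq0 !subr_eq0 => Da.
  split=> //.
    transitivity (a ^+ 2 * (a ^+ 2 + a3) + 0); last by rewrite addr0.
    rewrite -{}F0 a2E.
    apply: (@mod2 (- (a ^+ 4 + a ^+ 2 * a3 + a ^+ 2 * (b ^+ 2 + b)))); ring.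
  case/orP: Da => [/orP[]|] /eqP E; [by constructor 1|by constructor 2|].
  by constructor 3; rewrite E; apply: (@mod2 (-1)); ring.
split.
  apply: (@mod2 (a ^+ 4 + a ^+ 2 * a3 + a ^+ 2 * (b ^+ 2 + b))); ring.
have Da : (a - a3) * (a - b) * (a - (b + 1)) + (a ^+ 2 - a ^+ 2) * (a + 1) = 0.
  case: abc => ->; [ring|ring|].
  by apply: (@mod2 (a - a3)); ring.
by split=> //; ring.
Qed.

(** A cubic with leading coefficient a4 = 1 cannot vanish at four distinct
    coordinates. *)
Lemma singular_coord_eq a1 a2 a3 (x : 'rV[K]_4) :
  singular_at (quartic a1 a2 a3 1) x -> exists i j, i != j /\ x 0 i = x 0 j.
Proof.
move=> /singular_quarticP[_ dF].
have [xinj|] := boolP (injectiveb (x 0)); last first.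
  by move=> /injectivePn[i [j ij xij]]; exists i, j.
pose p := Poly [:: a2 * elemsym 1 x ^+ 3
                   + a3 * (elemsym 3 x + elemsym 1 x * elemsym 2 x)
                   + 1 * elemsym 3 x;
                   (a2 + a3) * elemsym 1 x ^+ 2 + 1 * elemsym 2 x;
                   (a3 + 1) * elemsym 1 x; 1].
have pE t : p.[t] = dquartic a2 a3 1 x t.
  by rewrite horner_Poly /dquartic /=; ring.
have p0 : p != 0.
  apply/eqP => /polyP/(_ 3%N)/eqP.
  by rewrite coef_Poly coef0 oner_eq0.
have := @max_poly_roots _ p [seq x 0 i | i <- enum 'I_4] p0.
rewrite size_map size_enum_ord.
case/(_ _ _)/Wrap.
- by apply/allP => _ /mapP[i _ ->]; rewrite /root pE dF.
- by rewrite map_inj_uniq ?enum_uniq //; apply/injectiveP.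
by rewrite ltnNge size_Poly.
Qed.

Lemma perm_moves_pair n (i j : 'I_n.+2) : i != j ->
  exists s : 'S_n.+2, s 0 = i /\ s 1 = j.
Proof.
move=> ij; pose k := tperm 0 i j.
have k0 : k != 0 by rewrite -(tpermR 0 i) (inj_eq perm_inj) eq_sym.
exists (tperm 1%R k * tperm 0%R i)%g; rewrite !permM; split.
  by rewrite (tpermD _ k0) ?oner_neq0 // tpermL.
by rewrite tpermL /k tpermK.
Qed.

Lemma singular_sum1 a1 a2 a3 (x : 'rV[K]_4) :
  elemsym 1 x = 1 -> singular_at (quartic a1 a2 a3 1) x ->
  exists s a b, col_perm s x = vec4 a a b (b + 1).
Proof.
move=> e1 /singular_coord_eq[i [j [ij xij]]].
have [s [s0 s1]] := perm_moves_pair ij.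
exists s, (x 0 i), (x 0 (s 2%:R)).
rewrite [LHS]vec4_eta !mxE s0 s1 -xij.
congr vec4.
move: e1; rewrite -(elemsym_col_perm _ s) [col_perm _ _]vec4_eta.
rewrite !mxE s0 s1 -xij.
rewrite elemsym_vec4 /= => <-.
by apply: (@mod2 (- x 0 i - x 0 (s 2%:R))); ring.
Qed.

Lemma closed_field_sqrt (c : K) : exists r : K, r ^+ 2 = c.
Proof.
have [r rE] := @solve_monicpoly K 2 (fun k => if k is 0%N then c else 0) isT.
by exists r; rewrite rE !big_ord_recl big_ord0 /=; ring.
Qed.

(** On the plane where the coordinate sum is 0 the equation of the quartic
    reduces to x1 x2 x3 x4 = 0, so 0 is a coordinate. Subtracting the value of
    the derivative cubic at that coordinate leaves t (t - r)^2 with r^2 = e_2,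
    so every coordinate is 0 or r; the number of coordinates r is even because
    their sum vanishes. *)
Lemma singular_sum0 a1 a2 a3 (x : 'rV[K]_4) :
  x != 0 -> elemsym 1 x = 0 -> singular_at (quartic a1 a2 a3 1) x ->
  exists (A : {set 'I_4}) (r : K),
    [/\ #|A| = 2%N, r != 0 & x = r *: (\row_j (j \in A)%:R)].
Proof.
move=> x0 e1 /singular_quarticP[]; rewrite e1 !expr0n /= => F0 dF.
have /eqP : elemsym 4 x = 0 by rewrite -[RHS]F0; ring.
rewrite elemsym4E => /prodf_eq0[i _ /eqP xi].
have [r rE] := closed_field_sqrt (elemsym 2 x).
have x0r j : x 0 j != 0 -> x 0 j = r.
  move=> xj; have : x 0 j * (x 0 j - r) ^+ 2 = 0.
    transitivity (dquartic a2 a3 1 x (x 0 j) - dquartic a2 a3 1 x (x 0 i)).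
      rewrite /dquartic e1 xi -rE.
      by apply: (@mod2 (- x 0 j ^+ 2 * r)); ring.
    by rewrite !dF subrr.
  by move=> /eqP; rewrite mulf_eq0 (negPf xj) expf_eq0 /= subr_eq0 => /eqP.
pose A := [set j | x 0 j != 0]%SET.
have xE : x = r *: (\row_j (j \in A)%:R).
  apply/rowP => j; rewrite !mxE inE.
  by case: eqVneq => [->|/x0r->]; rewrite ?mulr0 ?mulr1.
have r0 : r != 0 by apply: contraNneq x0 => r0; rewrite xE r0 scale0r.
exists A, r; split=> //.
have A2 : ~~ odd #|A|.
  move: e1; rewrite elemsym1E xE.
  under eq_bigr do rewrite !mxE.
  rewrite -mulr_sumr -natr_sum => /eqP; rewrite mulf_eq0 (negPf r0) /=.
  by rewrite -(dvdn_pcharf charK) dvdn2 -big_mkcond /= sum1_card.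
have A4 : (#|A| < 4)%N.
  suff: (#|A| < #|'I_4|)%N by rewrite card_ord.
  apply: proper_card; rewrite properE subset_predT /=.
  by apply/subsetPn; exists i => //; rewrite inE xi eqxx.
have A0 : (0 < #|A|)%N.
  by have /rV0Pn[j xj] := x0; apply/card_gt0P; exists j; rewrite inE.
by case: #|A| A2 A4 A0 => [|[|[|[|]]]].
Qed.
End CharTwo.

(** * Orbits of points whose coordinates take two values *)

Section Orbits.
Variable K : fieldType.
Implicit Types (A B : {set 'I_4}) (a : K) (u v : 'rV[K]_4).

Lemma proj_class_eqP u v (u0 : u != 0) (v0 : v != 0) :
  proj_class u0 = proj_class v0 <-> exists2 c, c != 0 & v = c *: u.
Proof. by split=> [/eqmodP/asboolP|?]; last exact/eqmodP/asboolP. Qed.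

(** Up to scaling, the points of all the orbits in question have coordinates
    that take two values; after scaling these differ by 1, and the positions of
    the value [a + 1] form a set A. Permutations act on A only. *)
Definition twoval a A : 'rV[K]_4 := \row_j (a + (j \in A)%:R).

Lemma twoval_neq0 a A : (0 < #|A| < 4)%N -> twoval a A != 0.
Proof.
case/andP=> /card_gt0P[i iA] A4; apply/eqP => /rowP A0.
have [j jA] : exists j, j \notin A.
  apply/existsP; rewrite -negb_forall; apply/negP => /forallP AT.
  move: A4; rewrite (_ : A = [set: 'I_4]%SET) ?cardsT ?card_ord //.
  by apply/setP => k; rewrite inE AT.
have := A0 i; have := A0 j; rewrite !mxE iA (negPf jA) addr0 => ->.
by rewrite add0r => /eqP; rewrite oner_eq0.
Qed.

(** The symmetric group is transitive on the sets A of a given cardinal: the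
    indicator sequences of two such sets have the same entries up to order. *)
Lemma col_perm_twoval a A B : #|A| = #|B| ->
  exists s : 'S_4, col_perm s (twoval a A) = twoval a B.
Proof.
move=> AB.
have /tuple_permP[s sE] :
    perm_eq [tuple j \in B | j < 4] [tuple j \in A | j < 4].
  apply/allP => b _ /=.
  have cE (C : {set 'I_4}) : count (pred1 b) [tuple j \in C | j < 4] =
      #|if b then C else ~: C|%SET.
    rewrite count_map -sum1_count big_enum_cond /= sum1dep_card.
    by case: b; apply: eq_card => j; rewrite !inE; case: (j \in C).
  apply/eqP; rewrite !cE; case: b {cE} => /=; first by rewrite AB.
  by apply: (@addnI #|A|); rewrite {1}AB !cardsC.
exists s; apply/rowP => j; rewrite !mxE; congr (_ + _%:R).
have /(congr1 (fun t : seq bool => nth false t j)) := sE.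
by rewrite -!tnth_nth !tnth_mktuple => ->.
Qed.

Lemma sum_twoval_odd a A : 2%N \in [pchar K] -> odd #|A| ->
  \sum_j twoval a A 0 j = 1.
Proof.
move=> charK oddA; under eq_bigr do rewrite mxE.
rewrite big_split /= sumr_const card_ord -[4%N]/(2 * 2)%N mulrnA.
rewrite mulrn_pchar // add0r -natr_sum -big_mkcond /= sum1_card.
by rewrite -(GRing.natr_mod_pchar charK) modn2 oddA.
Qed.

(** Proportional vectors of this form are equal: if a = 0 they have the same
    support, and if the cardinal of A is odd the coordinate sum is 1 in
    characteristic 2, which leaves no room for a scalar. *)
Lemma twoval_class_inj a A B (hA : twoval a A != 0) (hB : twoval a B != 0) :
  2%N \in [pchar K] -> #|A| = #|B| -> a = 0 \/ odd #|A| ->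
  proj_class hA = proj_class hB -> A = B.
Proof.
move=> charK AB aA /proj_class_eqP[c c0 /rowP cE].
case: aA => [a0|oddA].
  apply/setP => j; have := cE j; rewrite !mxE a0 !add0r.
  case: (j \in A); case: (j \in B) => //= /eqP; last by rewrite mulr0 oner_eq0.
  by rewrite mulr1 eq_sym (negPf c0).
have c1 : c = 1.
  rewrite -[c]mulr1 -[in LHS](sum_twoval_odd a charK oddA) mulr_sumr.
  have oddB : odd #|B| by rewrite -AB.
  rewrite -[RHS](sum_twoval_odd a charK oddB).
  by apply: eq_bigr => j _; rewrite [in RHS]cE [RHS]mxE.
apply/setP => j; have := cE j; rewrite !mxE c1 mul1r => /addrI/eqP.
by case: (j \in A); case: (j \in B); rewrite //= ?oner_eq0 // eq_sym oner_eq0.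
Qed.

Section TwoValOrbit.
Variables (a : K) (k : nat) (k04 : (0 < k < 4)%N).

Definition twoval_pt (A : {A : {set 'I_4} | #|A| == k}) : P3 K :=
  proj_class (@twoval_neq0 a (val A)
    (etrans (congr1 (fun k => 0 < k < 4)%N (eqP (valP A))) k04)).

Lemma range_twovalP v (v0 : v != 0) :
  range twoval_pt (proj_class v0) <->
  exists A c, [/\ #|A| = k, c != 0 & v = c *: twoval a A].
Proof.
split=> [[A _ /proj_class_eqP[c c0 vE]]|[A [c [/eqP Ak c0 vE]]]].
  by exists (val A), c; split=> //; apply/eqP/(valP A).
exists (exist (fun A : {set 'I_4} => #|A| == k) A Ak) => //.
by apply/proj_class_eqP; exists c.
Qed.

Lemma S4orbit_twoval v (v0 : v != 0) A c :
  #|A| = k -> c != 0 -> v = c *: twoval a A ->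
  S4orbit (proj_class v0) = range twoval_pt.
Proof.
move=> Ak c0 vE; apply/seteqP; split=> [_ [s _ <-]|_ [B _ <-]].
  rewrite S4act_class; apply/range_twovalP.
  exists (s @^-1: A)%SET, c; rewrite card_preimset; last exact: perm_inj.
  by split=> //; rewrite vE; apply/rowP => j; rewrite !mxE inE.
have [s sE] : exists s : 'S_4, col_perm s (twoval a A) = twoval a (val B).
  by apply: col_perm_twoval; rewrite Ak (eqP (valP B)).
exists s => //; rewrite S4act_class; apply/proj_class_eqP.
exists c^-1; first by rewrite invr_eq0.
by rewrite vE -sE; apply/rowP => j; rewrite !mxE mulKf.
Qed.

Lemma card_range_twoval : 2%N \in [pchar K] -> a = 0 \/ odd k ->
  range twoval_pt #= `I_('C(4, k)).
Proof.
move=> charK ak.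
have inj : injective twoval_pt.
  move=> A B /twoval_class_inj AB; apply: val_inj; apply: AB => //.
    by rewrite (eqP (valP A)) (eqP (valP B)).
  by rewrite (eqP (valP A)).
rewrite (card_eql (inj_card_eq (in2W inj))).
have <- : #|{: {A : {set 'I_4} | #|A| == k}}| = 'C(4, k).
  by rewrite card_sig -cardsE card_draws card_ord.
apply/pcard_eqP/bijPex.
exists (fun A : {A : {set 'I_4} | #|A| == k} => val (enum_rank A)); split=> //.
- by move=> A _; exact: ltn_ord.
- by move=> A B _ _ /val_inj/enum_rank_inj.
- by move=> i /= ik; exists (enum_val (Ordinal ik)); rewrite ?enum_valK.
Qed.
End TwoValOrbit.
End Orbits.

(** * Cardinality *)

(** If x ranges over a finite list s, the polynomial 1 + prod (X - x) has no
    root in s. *)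
Lemma infinite_closedField (K : closedFieldType) : infinite_set [set: K].
Proof.
move=> /finite_seqP[s sE].
have sK x : x \in s by have : [set: K] x by []; rewrite sE.
pose p : {poly K} := \prod_(x <- s) ('X - x%:P).
have /closed_rootP[x] : size (p + 1) != 1%N.
  have s0 : (0 < size s)%N by case: s sK {sE p} => // /(_ 0).
  by rewrite size_polyDl size_prod_XsubC ?size_poly1 // eqSS -lt0n.
have /rootP px : root p x by rewrite root_prod_XsubC.
by rewrite /root hornerD px add0r hornerC oner_eq0.
Qed.

Lemma infinite_set_curve (K : closedFieldType) T (f : K -> T) (S : set T) :
  injective f -> (forall t, S (f t)) -> infinite_set S.
Proof.
move=> finj fS; apply: (@sub_infinite_set _ (range f)).
  by move=> _ [t _ <-].
rewrite (eq_finite_set (inj_card_eq (in2W finj))).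
exact: infinite_closedField.
Qed.

Lemma card_eq_setU (T : choiceType) (A B : set T) m n :
  A #= `I_m -> B #= `I_n -> A `&` B = set0 -> A `|` B #= `I_(m + n).
Proof.
move=> Am Bn AB.
have /finite_fsetP[X XE] : finite_set A by exists m.
have /finite_fsetP[Y YE] : finite_set B by exists n.
move: Am Bn AB; rewrite XE YE => /card_eq_fsetP Xm /card_eq_fsetP Yn XY.
have -> : [set` X] `|` [set` Y] = [set` (X `|` Y)%fset].
  by apply/seteqP; split=> x /=; rewrite inE => /orP.
apply/card_eq_fsetP; rewrite cardfsU Xm Yn.
rewrite (_ : (X `&` Y)%fset = fset0) ?cardfs0 ?subn0 //.
apply/fsetP => x; rewrite !inE; apply/negP => /andP[xX xY].
by have : ([set` X] `&` [set` Y]) x by []; rewrite XY.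
Qed.

(** * Classification of the singular loci *)

Section Classification.
Variables (K : closedFieldType) (charK : 2%N \in [pchar K]).

Lemma proj_classP (p : P3 K) : exists v (v0 : v != 0), p = proj_class v0.
Proof.
have : p = \pi_(P3 K)%qT (repr p) by rewrite reprK.
by case: (repr p) => v v0 ->; exists v, v0.
Qed.

Lemma singular_points_quarticP (a1 a2 a3 a4 : K) v (v0 : v != 0) :
  singular_points (quartic a1 a2 a3 a4) (proj_class v0) <->
  singular_at (quartic a1 a2 a3 a4) v.
Proof. exact/singular_points_class/quartic_homog. Qed.

Lemma singular_pointsZ (c : K) (F : {mpoly K[4]}) : c != 0 ->
  singular_points (c *: F) = singular_points F.
Proof.
move=> c0; have c0E x : c * x = 0 <-> x = 0.
  by split=> [/eqP|->]; rewrite ?mulr0 // mulf_eq0 (negPf c0) => /eqP.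
rewrite /singular_points /singular_at; apply/seteqP.
split=> p /= -[]; rewrite mevalZ => /c0E F0 dF; split=> // i; apply/c0E.
  by rewrite -mevalZ -mderivZ.
by rewrite mderivZ mevalZ dF !mulr0.
Qed.

(** The orbits of (0, 0, 1, 1) and of (a, a, a, a + 1), as images of the sets
    of two, respectively one, coordinate positions. *)
Local Notation pair_orbit := (range (twoval_pt (K := K) 0 (isT : 0 < 2 < 4)%N)).
Local Notation single_orbit a := (range (twoval_pt a (isT : 0 < 1 < 4)%N)).

Lemma twoval23 : vec4 0 0 1 1 = twoval 0 [set 2%:R; 3%:R]%SET :> 'rV[K]_4.
Proof.
by apply/rowP => -[[|[|[|[|]]]] // ?]; rewrite !mxE !inE /= add0r.
Qed.

Lemma twoval3 (a : K) : vec4 a a a (a + 1) = twoval a [set 3%:R]%SET.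
Proof.
by apply/rowP => -[[|[|[|[|]]]] // ?]; rewrite !mxE !inE /= ?addr0.
Qed.

Lemma twoval2 (a : K) : vec4 a a (a + 1) a = twoval a [set 2%:R]%SET.
Proof.
by apply/rowP => -[[|[|[|[|]]]] // ?]; rewrite !mxE !inE /= ?addr0.
Qed.

Lemma S4orbit_0011 : S4orbit (proj_class (vec0011_neq0 K)) = pair_orbit.
Proof.
apply: (@S4orbit_twoval _ _ _ _ _ _ [set 2%:R; 3%:R]%SET 1).
- by rewrite cards2.
- exact: oner_neq0.
- by rewrite scale1r twoval23.
Qed.

Lemma pair_orbit_singular (a1 a2 a3 a4 : K) :
  pair_orbit `<=` singular_points (quartic a1 a2 a3 a4).
Proof.
rewrite -S4orbit_0011 => _ [s _ <-]; rewrite S4act_class.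
apply/singular_points_quarticP.
exact/(singular_col_perm charK)/(singular_vec0011 charK).
Qed.

Lemma col_perm_eq_twoval (s : 'S_4) (w : 'rV[K]_4) a A :
  col_perm s w = twoval a A ->
  exists B : {set 'I_4}, #|B| = #|A| /\ w = twoval a B.
Proof.
move=> /rowP sE; exists ((s^-1)%g @^-1: A)%SET.
rewrite card_preimset; last exact: perm_inj.
split=> //; apply/rowP => j.
by have := sE ((s^-1)%g j); rewrite !mxE inE permKV.
Qed.

Lemma pair_orbitP v (v0 : v != 0) (p := proj_class v0) a1 a2 a3 :
  singular_points (quartic a1 a2 a3 1) p -> pair_orbit p <-> elemsym 1 v = 0.
Proof.
rewrite singular_points_quarticP => v_sing; split.
  move=> /range_twovalP[A [c [A2 c0 ->]]].
  rewrite elemsym1E; under eq_bigr do rewrite !mxE add0r.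
  rewrite -mulr_sumr -natr_sum -big_mkcond sum1_card A2.
  by rewrite (pcharf0 charK) mulr0.
move=> e1; have [A [r [A2 r0 vE]]] := singular_sum0 charK v0 e1 v_sing.
apply/range_twovalP; exists A, r; split=> //; rewrite vE.
by apply/rowP => j; rewrite !mxE add0r.
Qed.

Section Normalized.
(* Square roots exist and are unique, so the coefficient a2 is written as
   a^2. *)
Variables a1 a a3 : K.
Let F := quartic a1 (a ^+ 2) a3 1.

(** Off the pair orbit the coordinate sum is nonzero, so it can be scaled
    to 1, and a permutation brings the point to the shape (a', a', b, b + 1);
    square roots are unique in characteristic 2, hence a' = a. *)
Lemma singular_off_pair_orbit p : (singular_points F `\` pair_orbit) p ->
  a1 = a ^+ 2 * (a ^+ 2 + a3) /\ (a = a3 \/ single_orbit a p).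
Proof.
have [v [v0 ->]] := proj_classP p; case=> v_sing.
move=> /(contra_not (pair_orbitP v_sing).2) /eqP.
move: v_sing; rewrite singular_points_quarticP => v_sing e0.
pose c := elemsym 1 v; pose w := c^-1 *: v.
have c0 : c^-1 != 0 by rewrite invr_eq0.
have w_sing : singular_at F w.
  exact/(singular_at_scale _ (quartic_homog _ _ _ _) c0).
have w1 : elemsym 1 w = 1 by rewrite elemsymZ expr1 mulVf.
have [s [a' [b wE]]] := singular_sum1 charK w1 w_sing.
have := (singular_col_perm charK a1 (a ^+ 2) a3 1 s w).2 w_sing.
rewrite wE => /(singular_double_coordP charK)[aa' a1E abc].
have {}aa' : a' = a.
  have : (a' - a) ^+ 2 = 0.
    rewrite sqrrB -aa'.
    by apply: (mod2 charK (q := a ^+ 2 - a' * a)); ring.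
  by move=> /eqP; rewrite expf_eq0 /= subr_eq0 => /eqP.
subst a'; split=> //.
case: abc wE => [a3E _|-> wE|-> wE]; first by left.
all: right; apply/range_twovalP.
all: have vE : v = c *: w by rewrite scalerA mulfV ?scale1r.
  have [B [B1 BE]] := col_perm_eq_twoval (etrans wE (twoval3 a)).
  by exists B, c; rewrite B1 cards1 vE BE.
have aK : a + 1 + 1 = a by apply: (mod2 charK (q := 1)); ring.
have [B [B1 BE]] :=
  col_perm_eq_twoval (etrans wE (etrans (congr1 _ aK) (twoval2 a))).
by exists B, c; rewrite B1 cards1 vE BE.
Qed.

Lemma single_orbit_singular :
  a1 = a ^+ 2 * (a ^+ 2 + a3) ->
  single_orbit a `<=` singular_points F `\` pair_orbit.
Proof.
move=> a1E _ [[A A1] _ <-]; rewrite /twoval_pt /=.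
have v_sing : singular_at F (twoval a A).
  have A3 : #|[set 3%:R : 'I_4]%SET| = #|A| by rewrite cards1 (eqP A1).
  have [s <-] := col_perm_twoval a A3.
  apply/(singular_col_perm charK); rewrite -twoval3.
  by apply/(singular_double_coordP charK); split=> //; constructor 2.
have p_sing := (singular_points_quarticP _ _ _ _ _).2 v_sing.
split; first exact: p_sing.
move=> /(pair_orbitP (p_sing _)); rewrite elemsym1E sum_twoval_odd ?(eqP A1) //.
by move/eqP; rewrite oner_eq0.
Qed.
End Normalized.

(** Without the term e_4 the quartic is singular along the curve
    e_1 = e_3 = 0, which contains the line of the points (1, 1, t, t). *)
Lemma infinite_singular_points_a4_eq0 (a1 a2 a3 : K) :
  infinite_set (singular_points (quartic a1 a2 a3 0)).
Proof.
have t0 (t : K) : vec4 1 1 t t != 0 by rewrite vec4_eq0 oner_eq0.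
apply: (infinite_set_curve (f := fun t => proj_class (t0 t))) => [t u|t].
  move=> /proj_class_eqP[c _ /rowP cE]; have := cE 2%:R; have := cE 0.
  by rewrite !mxE /= mulr1 => <-; rewrite mul1r.
exact/singular_points_quarticP/(singular_two_pairs charK).
Qed.

(** If a = a3, the first root of the derivative cubic accounts for the double
    coordinate a, and the other two coordinates t and t + 1 are free. *)
Lemma infinite_singular_points_line (a1 a : K) :
  a1 = a ^+ 2 * (a ^+ 2 + a) ->
  infinite_set (singular_points (quartic a1 (a ^+ 2) a 1)).
Proof.
move=> a1E.
pose v t := vec4 a a t (t + 1).
have v1 t : elemsym 1 (v t) = 1.
  by rewrite elemsym_vec4 /=; apply: (mod2 charK (q := a + t)); ring.
have v0 t : v t != 0.
  apply: contra_eq_neq (v1 t) => ->.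
  by rewrite -[0](scale0r 0) elemsymZ expr1 mul0r eq_sym oner_eq0.
apply: (infinite_set_curve (f := fun t => proj_class (v0 t))) => [t u|t].
  move=> /proj_class_eqP[c _ cE].
  have c1 : c = 1 by rewrite -(v1 u) cE elemsymZ v1 expr1 mulr1.
  by move: cE; rewrite c1 scale1r => /rowP/(_ 2%:R); rewrite !mxE.
apply/singular_points_quarticP/(singular_double_coordP charK).
by split=> //; constructor 1.
Qed.

Lemma single_orbit_normal_form (a : K) :
  single_orbit a = S4orbit (proj_class (vec0001_neq0 K)) \/
  exists b, single_orbit a = S4orbit (proj_class (vec111b_neq0 b)).
Proof.
have [->|a0] := eqVneq a 0; [left|right; exists ((a + 1) / a)]; symmetry.
  apply: (@S4orbit_twoval _ _ _ _ _ _ [set 3%:R]%SET 1).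
  - by rewrite cards1.
  - exact: oner_neq0.
  - by rewrite scale1r -twoval3 add0r.
apply: (@S4orbit_twoval _ _ _ _ _ _ [set 3%:R]%SET a^-1).
- by rewrite cards1.
- by rewrite invr_eq0.
rewrite -twoval3; apply/rowP => -[[|[|[|[|]]]] // ?]; rewrite !mxE /= ?mulVf //.
by rewrite mulrC.
Qed.

Lemma card_pair_orbit : pair_orbit #= `I_6.
Proof. by apply: (card_range_twoval _ charK); left. Qed.

Lemma singular_points_normalized (a1 a2 a3 : K)
    (S := singular_points (quartic a1 a2 a3 1)) :
  [\/ S #= `I_6,
      S #= `I_10 /\
      (S `\` pair_orbit = S4orbit (proj_class (vec0001_neq0 K)) \/
       exists b, S `\` pair_orbit = S4orbit (proj_class (vec111b_neq0 b)))
    | infinite_set S].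
Proof.
have [a aE] := closed_field_sqrt a2.
have pairS : pair_orbit `<=` S by exact: pair_orbit_singular.
have [a1E|a1N] := eqVneq a1 (a ^+ 2 * (a ^+ 2 + a3)); last first.
  constructor 1; suff -> : S = pair_orbit by exact: card_pair_orbit.
  apply/seteqP; split=> // p Sp; apply: contrapT => pair_p; move: a1N.
  rewrite /S -aE in Sp.
  by have [-> _] := singular_off_pair_orbit (conj Sp pair_p); rewrite eqxx.
have [a3E|a3N] := eqVneq a a3.
  constructor 3; rewrite /S -aE -a3E; apply: infinite_singular_points_line.
  by rewrite a1E -a3E.
have SE : S `\` pair_orbit = single_orbit a.
  rewrite /S -aE; apply/seteqP; split=> [p /singular_off_pair_orbit[_ []]|] //.
    by move=> /eqP; rewrite (negPf a3N).
  exact: single_orbit_singular.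
constructor 2; split.
  rewrite -(setDUK pairS) SE; apply: (@card_eq_setU _ _ _ 6 4).
  - exact: card_pair_orbit.
  - by apply: (card_range_twoval _ charK); right.
  - by rewrite -SE setDIK.
by rewrite SE; exact: single_orbit_normal_form.
Qed.

End Classification.

Theorem theorem12 (K : closedFieldType) (charK : 2%N \in [pchar K])
    (a1 a2 a3 a4 : K) (a_neq0 : (a1, a2, a3, a4) != (0, 0, 0, 0)) :
  let sigma (i : nat) : {mpoly K[4]} := mesym 4 K i in
  let F : {mpoly K[4]} :=
    a1 *: sigma 1%N ^+ 4 + a2 *: (sigma 1%N ^+ 2 * sigma 2%N)
    + a3 *: (sigma 1%N * sigma 3%N) + a4 *: sigma 4%N in
  let SingX : set (P3 K) := singular_points F in
  let O0011 : set (P3 K) := S4orbit (proj_class (vec0011_neq0 K)) in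
  [/\ O0011 #= `I_6,
      O0011 `<=` SingX &
      [\/ SingX #= `I_6,
          SingX #= `I_10 /\
          (SingX `\` O0011 = S4orbit (proj_class (vec0001_neq0 K)) \/
           exists b : K,
             SingX `\` O0011 = S4orbit (proj_class (vec111b_neq0 b)))
        | infinite_set SingX]].
Proof.
move=> sigma F SingX O0011; rewrite /O0011 S4orbit_0011; split.
- exact: card_pair_orbit.
- exact: pair_orbit_singular.
have [a40|a4N] := eqVneq a4 0.
  constructor 3; rewrite /SingX /F a40.
  exact: infinite_singular_points_a4_eq0.
have -> : SingX =
    singular_points (quartic (a4^-1 * a1) (a4^-1 * a2) (a4^-1 * a3) 1).
  rewrite -(singular_pointsZ _ a4N) /quartic !scalerDr !scalerA !mulVKf //.
  by rewrite mulr1.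
exact: singular_points_normalized.
Qed.
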